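(* (Extended Liouville Theorem) Suppose that the complex power series $f(z)=\sum_{n=0}^{+\infty}a_nz^n$ converges for every $z\in\mathbb{C}$. If there are constants $A\ge 0$, $B\ge 0$ and $N\in\mathbb{N}$ such that $$|f(z)|\le A+B|z|^N\quad\text{for all } z\in\mathbb{C},$$ then $f$ is a polynomial and $\deg(f)\le N$.
   Context: $\mathbb{N}=\{0,1,2,\dots\}$. *)

(* Defs.v *)
From mathcomp Require Import all_boot all_order all_algebra.
From mathcomp Require Import complex.
From mathcomp Require Import all_classical all_reals all_analysis.
Import Order.TTheory GRing.Theory Num.Theory numFieldNormedType.Exports.

Set Implicit Arguments.
Unset Strict Implicit.
Unset Printing Implicit Defensive.

Local Open Scope classical_set_scope.
Local Open Scope ring_scope.
Local Open Scope complex_scope.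

(* [pseries] of mathcomp.analysis.exp is restricted to real coefficients.
   The codomain is R[i]^o because the topology given by the modulus is inferred
   on the regular algebra R[i]^o and not on R[i] itself. *)
Definition cpseries (R : realType) (a : nat -> R[i]) (z : R[i])
    : nat -> R[i]^o :=
  [series a n * z ^+ n]_n.

(* Main.v *)
Require Import Defs.
From mathcomp Require Import all_boot all_order all_algebra.
From mathcomp Require Import complex.
From mathcomp Require Import all_classical all_reals all_analysis.
From mathcomp Require Import cyclic separable cyclotomic.
From mathcomp Require Import ring.
Import Order.TTheory GRing.Theory Num.Theory numFieldNormedType.Exports.

(** The proof is that of Liouville's theorem by Cauchy's inequalities, with the
    contour integral replaced by a finite mean over roots of unity.

    For a polynomial p bounded by K on the circle of radius r, averaging
    p(r w^l) / w^(l k) over the powers of a primitive root of unity w of large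
    order isolates the k-th term, whence |p_k| r^k <= K
    ([poly_cauchy_inequality]).  The partial sums of an everywhere convergent
    power series converge uniformly on every circle about 0
    ([cpseries_uniform_on_circle]), so on |z| = r those of f are bounded by
    A + B r^N + e for every e > 0 from some rank on.  Applied to them, Cauchy's
    inequality gives |a_k| r^k <= A + B r^N for all r > 0.  Letting r grow forces
    a_k = 0 for k > N ([eq0_of_growth]), so the partial sums are stationary and
    f is the polynomial of coefficients a_0, ..., a_N. *)

Set Implicit Arguments.
Unset Strict Implicit.
Unset Printing Implicit Defensive.

Local Open Scope classical_set_scope.
Local Open Scope ring_scope.
Local Open Scope complex_scope.

(** In characteristic 0 the polynomial X^n - 1 is separable, so over an
    algebraically closed field it has n distinct roots; a finite group of roots
    of unity being cyclic, one of them generates the others. *)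
Lemma exists_prim_root (C : numClosedFieldType) (n : nat) :
  (0 < n)%N -> exists w : C, n.-primitive_root w.
Proof.
move=> n_gt0; have [rs] := closed_field_poly_normal ('X^n - 1 : {poly C}).
rewrite (monicP (monicXnsubC 1 n_gt0)) scale1r => def_rs.
have rs_unity : all n.-unity_root rs.
  by apply/allP => w; rewrite -root_prod_XsubC -def_rs.
have size_rs : (n <= size rs)%N.
  by rewrite -ltnS -(size_prod_XsubC rs id) -def_rs size_XnsubC.
have rs_uniq : uniq rs.
  by rewrite -separable_prod_XsubC -def_rs separable_Xn_sub_1 // pnatr_eq0 -lt0n.
have /hasP[w _ prim_w] := has_prim_root n_gt0 rs_unity rs_uniq size_rs.
by exists w.
Qed.

Lemma norm_prim_root (C : numClosedFieldType) (n : nat) (w : C) :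
  n.-primitive_root w -> `|w| = 1.
Proof.
move=> prim_w; apply/eqP; rewrite -(@pexpr_eq1 _ _ n) //.
  by rewrite -normrX prim_expr_order ?normr1.
exact: prim_order_gt0 prim_w.
Qed.

(** The left-hand side is a geometric sum of ratio x = w^i / w^j.  Since x^n = 1,
    it vanishes unless x = 1, and x = 1 only for i = j. *)
Lemma prim_root_orthogonality (C : numClosedFieldType) (n : nat) (w : C)
    (i j : 'I_n) : n.-primitive_root w ->
  \sum_(l < n) (w ^+ l) ^+ i / (w ^+ l) ^+ j = n%:R * (i == j)%:R.
Proof.
move=> prim_w.
have w_neq0 : w != 0 by rewrite -normr_eq0 (norm_prim_root prim_w) oner_eq0.
have wX_neq0 m : w ^+ m != 0 by rewrite expf_neq0.
pose x := w ^+ i / w ^+ j.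
have -> : \sum_(l < n) (w ^+ l) ^+ i / (w ^+ l) ^+ j = \sum_(l < n) x ^+ l.
  apply: eq_bigr => l _.
  by rewrite exprMn exprVn -!exprM ![(l * _)%N]mulnC.
have [eq_ij|neq_ij] := eqVneq i j.
  rewrite mulr1 /x eq_ij divff //.
  by under eq_bigr do rewrite expr1n; rewrite sumr_const card_ord.
have x_neq1 : x - 1 != 0.
  rewrite subr_eq0 -(inj_eq (mulIf (wX_neq0 j))) /x divfK // mul1r.
  by rewrite (eq_prim_root_expr prim_w) !modn_small.
apply/(mulfI x_neq1); rewrite -subrX1 !mulr0.
rewrite exprMn exprVn -!exprM ![(_ * n)%N]mulnC !exprM (prim_expr_order prim_w).
by rewrite !expr1n invr1 mulr1 subrr.
Qed.

(** The discrete form of Cauchy's integral formula: when w is a primitive n-th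
    root of unity with n larger than k and the degree of p, the mean of
    p(r w^l) / w^(l k) over l < n is exactly the k-th term p_k r^k.  This mean
    is at most the maximum of |p| on the circle of radius r. *)
Lemma poly_cauchy_inequality (C : numClosedFieldType) (p : {poly C}) (r K : C) :
  0 <= r -> (forall z, `|z| = r -> `|p.[z]| <= K) ->
  forall k, `|p`_k| * r ^+ k <= K.
Proof.
move=> r_ge0 p_le k; pose n := maxn (size p) k.+1.
have n_gt0 : (0 < n)%N by rewrite leq_max orbT.
have k_lt : (k < n)%N by rewrite leq_max ltnSn orbT.
have [w prim_w] := exists_prim_root C n_gt0.
have w_norm := norm_prim_root prim_w.
have mean : \sum_(l < n) p.[r * w ^+ l] / (w ^+ l) ^+ k = n%:R * (p`_k * r ^+ k).
  transitivity (\sum_(i < n) (p`_i * r ^+ i) *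
      \sum_(l < n) (w ^+ l) ^+ i / (w ^+ l) ^+ Ordinal k_lt).
    under [RHS]eq_bigr do rewrite big_distrr /=.
    rewrite exchange_big; apply: eq_bigr => l _ /=.
    rewrite (horner_coef_wide _ (leq_maxl (size p) k.+1)) -/n big_distrl /=.
    by apply: eq_bigr => i _; rewrite exprMn !mulrA.
  under eq_bigr do rewrite prim_root_orthogonality //.
  rewrite (bigD1 (Ordinal k_lt)) //= eqxx mulr1 big1 ?addr0 1?mulrC //.
  by move=> i /negPf->; rewrite !mulr0.
have n_posR : 0 < n%:R :> C by rewrite ltr0n.
have -> : `|p`_k| * r ^+ k = `|p`_k * r ^+ k|.
  by rewrite normrM normrX (ger0_norm r_ge0).
rewrite -(ler_pM2l n_posR) -[X in X * `|_|](ger0_norm (ltW n_posR)) -normrM -mean.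
apply: le_trans (ler_norm_sum _ _ _) _.
rewrite mulr_natl -[X in _ *+ X](card_ord n) -sumr_const; apply: ler_sum => l _.
rewrite normrM normfV !normrX w_norm !expr1n invr1 mulr1; apply: p_le.
by rewrite normrM normrX w_norm expr1n mulr1 ger0_norm.
Qed.

(** For r >= 1 the hypothesis yields c r <= A + B, which fails at
    r = 1 + (A + B) / c when c > 0. *)
Lemma eq0_of_growth (F : numFieldType) (c A B : F) (N k : nat) :
  0 <= c -> 0 <= A -> 0 <= B -> (N < k)%N ->
  (forall r, 0 < r -> c * r ^+ k <= A + B * r ^+ N) -> c = 0.
Proof.
move=> c_ge0 A_ge0 B_ge0 ltNk growth; apply/eqP; rewrite eq_le c_ge0 andbT.
have [->//|c_neq0] := eqVneq c 0.
have c_gt0 : 0 < c by rewrite lt_def c_neq0.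
pose r := 1 + (A + B) / c.
have r_ge1 : 1 <= r by rewrite lerDl divr_ge0 ?addr_ge0.
have r_gt0 : 0 < r := lt_le_trans ltr01 r_ge1.
have rN_ge1 : 1 <= r ^+ N by rewrite exprn_ege1.
have le1 : c * r ^+ N.+1 <= c * r ^+ k by rewrite ler_pM2l // ler_weXn2l.
have le2 : A + B * r ^+ N <= (A + B) * r ^+ N.
  by rewrite mulrDl lerD2r ler_peMr.
have := le_trans le1 (le_trans (growth r r_gt0) le2).
rewrite exprS mulrA ler_pM2r; last exact: lt_le_trans ltr01 rN_ge1.
by rewrite /r mulrDr mulr1 mulrC divfK // gerDr.
Qed.

Lemma cpseriesE (R : realType) (a : nat -> R[i]) (z : R[i]) (n : nat) :
  cpseries a z n = (\poly_(i < n) a i).[z].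
Proof. by rewrite horner_poly /cpseries /series /= big_mkord. Qed.

Lemma cpseriesS (R : realType) (a : nat -> R[i]) (z : R[i]) (n : nat) :
  cpseries a z n.+1 = cpseries a z n + a n * z ^+ n.
Proof. by rewrite /cpseries /series /= big_nat_recr. Qed.

(** Convergence at the single point 2 r already controls the series on the whole
    circle of radius r: if the partial sums at 2 r are within d of their limit
    from rank n0 on, then |a_m| (2 r)^m <= 2 d for m >= n0, so that for |z| = r
    the m-th term is at most 2 d / 2^m and the tail after n is at most 4 d.
    Because d may be chosen in advance, no power of 2 has to be compared
    with e. *)
Lemma cpseries_uniform_on_circle (R : realType) (a : nat -> R[i])
    (f : R[i] -> R[i]) (r e : R[i]) :
  (forall z : R[i], cpseries a z @ \oo --> (f z : R[i]^o)) -> 0 < r -> 0 < e ->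
  exists n0, forall n z, (n0 <= n)%N -> `|z| = r -> `|f z - cpseries a z n| <= e.
Proof.
move=> f_sum r_gt0 e_gt0; pose d := e / 5%:R.
have d_gt0 : 0 < d by rewrite divr_gt0 ?ltr0n.
have near_f z : exists n0, forall n, (n0 <= n)%N -> `|f z - cpseries a z n| < d.
  have /cvgrPdist_lt/(_ d d_gt0)[n0 _ near_n0] := f_sum z.
  by exists n0 => n len; exact: near_n0.
have [n0 near_n0] := near_f (2%:R * r); exists n0 => n z le_n0n z_norm.
(* The factor 1 / 2^n is dropped: 1 / 2^m suffices for a summable bound. *)
have term_le m : `|a (n + m)%N * z ^+ (n + m)| <= d * 2%:R / 2%:R ^+ m.
  have two_gt0 : (0 : R[i]) < 2%:R ^+ m by rewrite exprn_gt0 ?ltr0n.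
  have le_n0 : (n0 <= n + m)%N := leq_trans le_n0n (leq_addr m n).
  have : `|a (n + m)%N * (2%:R * r) ^+ (n + m)| <= d * 2%:R.
    have -> : a (n + m)%N * (2%:R * r) ^+ (n + m) =
        (f (2%:R * r) - cpseries a (2%:R * r) (n + m)) -
        (f (2%:R * r) - cpseries a (2%:R * r) (n + m).+1).
      by rewrite cpseriesS; ring.
    apply: le_trans (ler_normB _ _) _; rewrite mulr_natr mulr2n.
    by apply: lerD; apply/ltW/near_n0 => //; exact: leqW.
  rewrite ler_pdivlMr //; apply: le_trans.
  have z_scale : 2%:R ^+ m * `|z| ^+ (n + m) <= `|2%:R * r| ^+ (n + m).
    rewrite z_norm normrM (gtr0_norm r_gt0) normr_nat exprMn.
    rewrite ler_pM2r ?exprn_gt0 //.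
    by rewrite ler_weXn2l ?leq_addl // ler1n.
  rewrite !(normrM (a _)) !normrX -mulrA ler_wpM2l //.
  by rewrite mulrC.
have tail_le m : `|cpseries a z (n + m)%N - cpseries a z n|
    <= 4%:R * d * (1 - 2%:R ^- m).
  elim: m => [|m IHm].
    by rewrite addn0 !subrr normr0 expr0 invr1 subrr mulr0.
  rewrite addnS cpseriesS addrAC.
  apply: le_trans (ler_normD _ _) _; apply: le_trans (lerD IHm (term_le m)) _.
  rewrite le_eqVlt; apply/orP; left; apply/eqP.
  by rewrite exprS; field; rewrite expf_neq0 ?pnatr_eq0.
(* The rank n1 depends on z, but the bound on the tail does not. *)
have [n1 near_n1] := near_f z.
have -> : f z - cpseries a z n = (f z - cpseries a z (n + n1)%N) +
    (cpseries a z (n + n1)%N - cpseries a z n) by ring.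
apply: le_trans (ler_normD _ _) _.
have -> : e = d + 4%:R * d by rewrite /d; field.
apply: lerD; first by apply/ltW/near_n1/leq_addl.
by apply: le_trans (tail_le n1) _; rewrite ger_pMr ?mulr_gt0 ?ltr0n.
Qed.

Theorem mainTheorem5 (R : realType) (a : nat -> R[i]) (f : R[i] -> R[i])
    (f_sum : forall z : R[i], cpseries a z @ \oo --> (f z : R[i]^o))
    (A B : R) (N : nat) (A_ge0 : 0 <= A) (B_ge0 : 0 <= B)
    (f_bound : forall z : R[i], `|f z| <= A%:C + B%:C * `|z| ^+ N) :
  exists p : {poly R[i]},
    (size p <= N.+1)%N /\ (forall z : R[i], f z = p.[z]).
Proof.
(* Cauchy's inequality for f itself, obtained from its partial sums. *)
have growth k r : 0 < r -> `|a k| * r ^+ k <= A%:C + B%:C * r ^+ N.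
  move=> r_gt0; apply/ler_addgt0Pr => e e_gt0.
  have [n0 near_n0] := cpseries_uniform_on_circle f_sum r_gt0 e_gt0.
  pose n := maxn n0 k.+1.
  have le_n0n : (n0 <= n)%N := leq_maxl _ _.
  have -> : a k = (\poly_(i < n) a i)`_k.
    by rewrite coef_poly ifT // leq_max ltnSn orbT.
  apply: (poly_cauchy_inequality (ltW r_gt0)) => z z_norm; rewrite -cpseriesE.
  have -> : cpseries a z n = f z - (f z - cpseries a z n) by ring.
  apply: le_trans (ler_normB _ _) _.
  by apply: lerD; [rewrite -z_norm; exact: f_bound | exact: near_n0].
have a_eq0 k : (N < k)%N -> a k = 0.
  move=> ltNk; apply/eqP; rewrite -normr_eq0; apply/eqP.
  by apply: (eq0_of_growth _ _ _ ltNk (growth k)); rewrite ?normr_ge0 ?ler0c.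
exists (\poly_(i < N.+1) a i); split; first exact: size_poly.
move=> z; apply: (cvg_unique (@norm_hausdorff _ R[i]^o) (f_sum z)).
apply: cvg_near_cst; exists N.+1 => // n /= ltNn.
rewrite cpseriesE; congr (_.[z]); apply/polyP => k; rewrite !coef_poly.
have [ltkN|leNk] := ltnP k N.+1; first by rewrite (leq_trans ltkN ltNn).
by rewrite a_eq0 // if_same.
Qed.
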